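(* Let $R$ be a ring. The graph $\mathbb{AG}(R)$ is a complete bipartite graph with a horn if and only if $R\cong D\times S$, where $D$ is an integral domain and $S$ is a ring with a unique non-trivial ideal. In this case, $\mathbb{AG}(R)\cong K_1+D_r+K_1+D_r$, where $r$ is either $1$ or an infinite cardinal number.
   Context: All rings are commutative with identity. The annihilating-ideal graph $\mathbb{AG}(R)$ of a ring $R$ is the simple graph whose vertices are the nonzero ideals $I$ of $R$ for which there exists a nonzero ideal $J$ of $R$ with $IJ=0$; distinct vertices $I,J$ are adjacent iff $IJ=0$. A non-trivial ideal is one that is nonzero and proper. Fields are integral domains. A complete bipartite graph with a horn, denoted $X-U-v-Y$, is a graph whose vertex set is a disjoint union $X\cup U\cup\{v\}\cup Y$ with $X,U,Y$ nonempty (of arbitrary cardinality), whose edges are exactly: all pairs between $X$ and $U$, all pairs between $U$ and $\{v\}$, and all pairs between $\{v\}$ and $Y$. $D_r$ denotes the discrete (edgeless) graph on $r$ vertices, and $K_1+D_r+K_1+D_r$ denotes the sequential sum: the disjoint union of the four graphs in the given order, with all edges added between consecutive ones. That is, it is the graph $X-U-v-Y$ with $|X|=1$ and $|U|=|Y|=r$. *)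

(* Defs.v *)
From mathcomp Require Import all_boot all_order all_algebra.
From mathcomp Require Import mathcomp_extra boolp classical_sets functions.
From mathcomp Require Import cardinality.

Set Implicit Arguments.
Unset Strict Implicit.
Unset Printing Implicit Defensive.

Import GRing.Theory.

Local Open Scope classical_set_scope.
Local Open Scope ring_scope.

(* Simple graphs, possibly infinite. *)
Record sgraph := SGraph {
  vertex :> Type;
  adj : vertex -> vertex -> Prop;
  adj_sym : forall x y, adj x y -> adj y x;
  adj_irrefl : forall x, ~ adj x x
}.

Definition graph_iso (G H : sgraph) : Prop :=
  exists f : G -> H, bijective f /\ forall x y, adj x y <-> adj (f x) (f y).

Definition all_pairs (T : Type) (A B : set T) (x y : T) : Prop :=
  (A x /\ B y) \/ (B x /\ A y).

(* G is of the form X - U - v - Y. *)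
Definition bipartite_with_horn (G : sgraph) : Prop :=
  exists (X U : set G) (v : G) (Y : set G),
    [/\ X !=set0, U !=set0 & Y !=set0] /\
    [/\ X `&` U = set0, X `&` [set v] = set0 & X `&` Y = set0] /\
    [/\ U `&` [set v] = set0, U `&` Y = set0 & [set v] `&` Y = set0] /\
    X `|` U `|` [set v] `|` Y = setT /\
    forall x y : G, adj x y <->
      [\/ all_pairs X U x y, all_pairs U [set v] x y | all_pairs [set v] Y x y].

(* The edgeless graph D_r, with the cardinal r represented by a type. *)
Program Definition discrete_graph (r : Type) : sgraph :=
  @SGraph r (fun _ _ => False) _ _.

(* K_n; only n = 1 is used below. *)
Program Definition complete_graph (n : nat) : sgraph :=
  @SGraph 'I_n (fun i j => i <> j) _ _.

Section SequentialSum.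
Variables A B C D : sgraph.

Inductive seq_sum_vertex : Type :=
| SS1 of A | SS2 of B | SS3 of C | SS4 of D.

Definition seq_sum_adj (x y : seq_sum_vertex) : Prop :=
  match x, y with
  | SS1 a, SS1 a' => adj a a'
  | SS2 b, SS2 b' => adj b b'
  | SS3 c, SS3 c' => adj c c'
  | SS4 d, SS4 d' => adj d d'
  | SS1 _, SS2 _ | SS2 _, SS1 _ => True
  | SS2 _, SS3 _ | SS3 _, SS2 _ => True
  | SS3 _, SS4 _ | SS4 _, SS3 _ => True
  | _, _ => False
  end.

Lemma seq_sum_adj_sym x y : seq_sum_adj x y -> seq_sum_adj y x.
Proof. by case: x y => [a|b|c|d] [a'|b'|c'|d'] //=; apply: adj_sym. Qed.

Lemma seq_sum_adj_irrefl x : ~ seq_sum_adj x x.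
Proof. by case: x => [a|b|c|d] /=; apply: adj_irrefl. Qed.

Definition seq_sum : sgraph := SGraph seq_sum_adj_sym seq_sum_adj_irrefl.

End SequentialSum.

(* [comPzRingType] includes the zero ring.  The library's [idealr] covers only
   proper decidable ideals of nonzero rings, hence the following notion. *)
Definition is_ideal (R : comPzRingType) (I : set R) : Prop :=
  [/\ I 0, (forall a b, I a -> I b -> I (a + b)) &
      (forall r a, I a -> I (r * a))].

Definition nontrivial_ideal (R : comPzRingType) (I : set R) : Prop :=
  [/\ is_ideal I, I <> [set 0] & I <> setT].

Definition ideal_mul (R : comPzRingType) (I J : set R) : set R :=
  [set x | exists (n : nat) (a b : 'I_n -> R),
     [/\ forall i, I (a i), forall i, J (b i) & x = \sum_(i < n) a i * b i]].

Lemma ideal_mulC (R : comPzRingType) (I J : set R) :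
  ideal_mul I J = ideal_mul J I.
Proof.
apply/seteqP; split=> x [n [a [b [Ha Hb ->]]]]; exists n, b, a; split=> //;
  by apply: eq_bigr => i _; rewrite mulrC.
Qed.

Definition AG_vertex (R : comPzRingType) (I : set R) : Prop :=
  [/\ is_ideal I, I <> [set 0] &
      exists J : set R,
        [/\ is_ideal J, J <> [set 0] & ideal_mul I J = [set 0]]].

Section AnnihilatingIdealGraph.
Variable R : comPzRingType.

Definition AG_adj (I J : {I : set R | AG_vertex I}) : Prop :=
  I <> J /\ ideal_mul (sval I) (sval J) = [set 0].

Lemma AG_adj_sym I J : AG_adj I J -> AG_adj J I.
Proof. by case=> neIJ IJ0; split; [exact: nesym | rewrite ideal_mulC]. Qed.

Lemma AG_adj_irrefl I : ~ AG_adj I I.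
Proof. by case. Qed.

Definition AG : sgraph := SGraph AG_adj_sym AG_adj_irrefl.

End AnnihilatingIdealGraph.

Definition ring_iso (R S : comPzRingType) : Prop :=
  exists f : {rmorphism R -> S}, bijective f.

Definition unique_nontrivial_ideal (S : comPzRingType) : Prop :=
  exists! I : set S, nontrivial_ideal I.

Definition one_or_infinite (r : Type) : Prop :=
  ([set: r] #= `I_1)%card \/ infinite_set [set: r].

(* Main.v *)
Require Import Defs.
From HB Require Import structures.
From mathcomp Require Import all_boot all_order all_algebra.
From mathcomp Require Import mathcomp_extra boolp classical_sets functions.
From mathcomp Require Import cardinality.
From mathcomp Require Import ring.

Set Implicit Arguments.
Unset Strict Implicit.
Unset Printing Implicit Defensive.

Import GRing.Theory.

Local Open Scope classical_set_scope.
Local Open Scope ring_scope.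

(** Write X - U - v - Y for the horn, and let x, u, y range over X, U, Y.

    If AG(R) is a horn, then R has an idempotent e for which eR has a single
    non-trivial ideal and (1 - e)R is a domain.  The graph leaves few
    possibilities for an ideal that kills two given vertices; applied to the
    products xy and the sums u + v, this shows that v is a minimal ideal and
    that xy = v or xy = u ([horn_mul_XY]).

    - If xy = v for some x and y, then v v = 0 because vy = 0, and no u has
      square zero.  Put K = Ann(u) and m = v ([horn_split_nilpotent]).
    - If xy is not v, then U = {u} and u u = 0, while v v <> 0.  Here u and v
      exchange their roles, as in the reflection of the path with four
      vertices: put K = Ann(v) and m = u ([horn_split_idempotent]).

    In both cases m is a minimal ideal with m m = 0, m is contained in K,
    K m <> 0, every element of K that kills m lies in m, and a product of
    nonzero elements of Ann(K) is nonzero.  The algebra is then the same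
    ([split_of_minimal_ideal]).  Since m is minimal and K m <> 0, some c in K
    acts as the identity on m; c - c^2 kills m, hence lies in m and has square
    zero; so c lifts to an idempotent e in K, and K = eR.  The decomposition
    R = (1 - e)R x eR is the one wanted.

    Conversely, let R = D x S with m the non-trivial ideal of S; then m m = 0
    by a Nakayama argument ([unique_nontrivial_idealP]).  The vertices of AG(R)
    are 0 x S, A x 0, 0 x m and A x m, with A a nonzero ideal of D, and they
    form the sets X, U, {v} and Y ([AG_product_iso]).  Hence |U| = |Y| is the
    number r of nonzero ideals of D: it is 1 if D is a field, and otherwise the
    powers of a nonzero nonunit generate infinitely many ideals. *)

(** * Corner rings and the decomposition given by an idempotent *)

Section Corner.
Variables (R : comPzRingType) (e : R) (He : e * e = e).

(** The ring eR, whose unit is e and not 1.  The proof of idempotence is an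
    argument of the type, so that the ring structure can be inferred from it. *)
Definition corner of e * e = e := {x : R | e * x == x}.
Local Notation C := (corner He).
HB.instance Definition _ := Choice.on C.

Definition to_corner (x : R) : C := exist _ (e * x) (introT eqP
  (etrans (mulrA e e x) (congr1 (fun y => y * x) He))).

Lemma mul_corner_val (a : C) : e * val a = val a.
Proof. exact/eqP/(svalP a). Qed.

Lemma val_to_corner x : val (to_corner x) = e * x.
Proof. by []. Qed.

Let add (a b : C) := to_corner (val a + val b).
Let opp (a : C) := to_corner (- val a).
Let mul (a b : C) := to_corner (val a * val b).

Fact val_corner_add a b : val (add a b) = val a + val b.
Proof. by rewrite val_to_corner mulrDr !mul_corner_val. Qed.
Fact val_corner_opp a : val (opp a) = - val a.
Proof. by rewrite val_to_corner mulrN mul_corner_val. Qed.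
Fact val_corner_mul a b : val (mul a b) = val a * val b.
Proof. by rewrite val_to_corner mulrA mul_corner_val. Qed.

Fact corner_addA : associative add.
Proof. by move=> a b c; apply: val_inj; rewrite !val_corner_add addrA. Qed.
Fact corner_addC : commutative add.
Proof. by move=> a b; apply: val_inj; rewrite !val_corner_add addrC. Qed.
Fact corner_add0 : left_id (to_corner 0) add.
Proof.
by move=> a; apply: val_inj; rewrite val_corner_add val_to_corner mulr0 add0r.
Qed.
Fact corner_addN : left_inverse (to_corner 0) opp add.
Proof.
move=> a; apply: val_inj.
by rewrite val_corner_add val_corner_opp val_to_corner mulr0 addNr.
Qed.
HB.instance Definition _ :=
  GRing.isZmodule.Build C corner_addA corner_addC corner_add0 corner_addN.

Fact corner_mulA : associative mul.
Proof. by move=> a b c; apply: val_inj; rewrite !val_corner_mul mulrA. Qed.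
Fact corner_mulC : commutative mul.
Proof. by move=> a b; apply: val_inj; rewrite !val_corner_mul mulrC. Qed.
Fact corner_mul1 : left_id (to_corner e) mul.
Proof.
move=> a; apply: val_inj.
by rewrite val_corner_mul val_to_corner He mul_corner_val.
Qed.
Fact corner_mulDl : left_distributive mul add.
Proof.
move=> a b c; apply: val_inj.
by rewrite val_corner_add !val_corner_mul val_corner_add mulrDl.
Qed.
HB.instance Definition _ := GRing.Zmodule_isComPzRing.Build C
  corner_mulA corner_mulC corner_mul1 corner_mulDl.

Lemma corner0E : val (0 : C) = 0.
Proof. by rewrite [LHS]val_to_corner mulr0. Qed.
Lemma corner1E : val (1 : C) = e.
Proof. by rewrite [LHS]val_to_corner He. Qed.
Lemma cornerDE (a b : C) : val (a + b) = val a + val b.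
Proof. exact: val_corner_add. Qed.
Lemma cornerNE (a : C) : val (- a) = - val a.
Proof. exact: val_corner_opp. Qed.
Lemma cornerME (a b : C) : val (a * b) = val a * val b.
Proof. exact: val_corner_mul. Qed.

Lemma to_cornerB x y : to_corner (x - y) = to_corner x - to_corner y.
Proof.
by apply: val_inj; rewrite val_to_corner cornerDE cornerNE !val_to_corner mulrBr.
Qed.

Lemma to_cornerM x y : to_corner (x * y) = to_corner x * to_corner y.
Proof.
apply: val_inj; rewrite [RHS]cornerME !val_to_corner.
by rewrite mulrACA He.
Qed.

Lemma to_corner1 : to_corner 1 = 1.
Proof. by apply: val_inj; rewrite corner1E val_to_corner mulr1. Qed.

End Corner.

Definition no_zero_divisors_in_corner (R : comPzRingType) (e : R) : Prop :=
  forall a b : R, e * a = a -> e * b = b -> a * b = 0 -> a = 0 \/ b = 0.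

Section DomainCorner.
Variables (R : comPzRingType) (e : R) (He : e * e = e).
Hypothesis e_neq0 : e <> 0.
Hypothesis e_domain : no_zero_divisors_in_corner e.

(** The same carrier under a name that records the two proofs from which the
    integral domain structure is inferred. *)
Definition domain_corner of e <> 0 & no_zero_divisors_in_corner e :=
  corner He.
Local Notation D := (domain_corner e_neq0 e_domain).
HB.instance Definition _ := GRing.ComPzRing.on D.

Fact domain_corner_oner_neq0 : (1 : D) != 0.
Proof.
apply/eqP => /(congr1 val) E; apply: e_neq0.
by move: E; rewrite [RHS](corner0E He) [LHS](corner1E He).
Qed.
HB.instance Definition _ :=
  GRing.PzSemiRing_isNonZero.Build D domain_corner_oner_neq0.

Let unit (a : D) : bool := `[< exists b : D, b * a = 1 >].
Let inv (a : D) : D :=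
  if pselect (exists b : D, b * a = 1) is left h then sval (cid h) else a.

Fact domain_corner_mulVr : {in unit, left_inverse 1 inv *%R}.
Proof.
move=> a; rewrite /unit unfold_in => /asboolP h; rewrite /inv.
by case: pselect => // h'; case: cid.
Qed.
Fact domain_corner_unitP (a b : D) : b * a = 1 -> unit a.
Proof. by move=> h; apply/asboolP; exists b. Qed.
Fact domain_corner_invr_out : {in [predC unit], inv =1 id}.
Proof.
move=> a; rewrite inE /= unfold_in => /asboolP h; rewrite /inv.
by case: pselect.
Qed.
HB.instance Definition _ := GRing.ComNzRing_hasMulInverse.Build D
  domain_corner_mulVr domain_corner_unitP domain_corner_invr_out.

Fact domain_corner_integral : GRing.integral_domain_axiom D.
Proof.
move=> a b /(congr1 val) E.
have ab0 : val (a : corner He) * val (b : corner He) = 0.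
  by rewrite -cornerME -(corner0E He).
have [a0|b0] := e_domain (@mul_corner_val _ _ He a) (@mul_corner_val _ _ He b) ab0.
- by apply/orP; left; apply/eqP/val_inj; rewrite [RHS](corner0E He).
- by apply/orP; right; apply/eqP/val_inj; rewrite [RHS](corner0E He).
Qed.
HB.instance Definition _ :=
  GRing.ComUnitRing_isIntegral.Build D domain_corner_integral.

End DomainCorner.

Section CornerDecomposition.
Variables (R : comPzRingType) (e e' : R).
Hypotheses (He : e * e = e) (He' : e' * e' = e') (ee' : e + e' = 1).
Hypotheses (e'_neq0 : e' <> 0) (e'_domain : no_zero_divisors_in_corner e').
Local Notation D := (domain_corner He' e'_neq0 e'_domain).

Lemma orthogonal_idempotents : e * e' = 0.
Proof. by rewrite -[e'](addKr e) ee' mulrDr mulrN He mulr1 addNr. Qed.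

Definition peirce (x : R) : (D * corner He)%type :=
  (to_corner He' x : D, to_corner He x).

Fact peirce_is_zmod_morphism : zmod_morphism peirce.
Proof. by move=> x y; congr pair; apply: to_cornerB. Qed.
HB.instance Definition _ := GRing.isZmodMorphism.Build
  R (D * corner He)%type peirce peirce_is_zmod_morphism.

Fact peirce_is_monoid_morphism : monoid_morphism peirce.
Proof.
split; first by congr pair; apply: to_corner1.
by move=> x y; congr pair; apply: to_cornerM.
Qed.
HB.instance Definition _ := GRing.isMonoidMorphism.Build
  R (D * corner He)%type peirce peirce_is_monoid_morphism.

Lemma peirce_bijective : bijective peirce.
Proof.
have e'S (b : corner He) : e' * val b = 0.
  by rewrite -(mul_corner_val b) mulrA [e' * e]mulrC orthogonal_idempotents mul0r.
have eD (a : corner He') : e * val a = 0.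
  by rewrite -(mul_corner_val a) mulrA orthogonal_idempotents mul0r.
exists (fun p => val (p.1 : corner He') + val p.2) => [x|[a b]] /=.
  by rewrite -mulrDl addrC ee' mul1r.
congr pair; apply: val_inj; rewrite val_to_corner mulrDr.
  by rewrite e'S addr0 mul_corner_val.
by rewrite eD add0r mul_corner_val.
Qed.

End CornerDecomposition.

(** The inclusion identifies the ideals of the ring eR with the ideals of R
    contained in eR, so that the uniqueness of the non-trivial ideal of eR can be
    checked inside R. *)
Lemma split_ring_iso (R : comPzRingType) (e e' : R) (m : set R) :
  e * e = e -> e' * e' = e' -> e + e' = 1 ->
  e' <> 0 -> no_zero_divisors_in_corner e' ->
  is_ideal m -> m <> [set 0] -> (forall a, m a -> e * a = a) -> ~ m e ->
  (forall w, is_ideal w -> w <> [set 0] -> (forall a, w a -> e * a = a) ->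
     w = m \/ w e) ->
  exists (D : idomainType) (S : comPzRingType),
    unique_nontrivial_ideal S /\ ring_iso R (D * S)%type.
Proof.
move=> He He' ee' e'0 e'D [m0 mD mM] mN0 me mNe mU.
exists (domain_corner He' e'0 e'D), (corner He); split; last first.
  exists (peirce He He' e'0 e'D); exact: peirce_bijective.
have nontrivE (I : set (corner He)) : is_ideal I ->
  [set x | exists2 a, I a & val a = x] = [set 0] -> I = [set 0].
  move=> [I0 _ _] E; apply/seteqP; split=> [a Ia|a ->] //=.
  apply: val_inj; rewrite corner0E.
  by have : [set 0] (val a) by rewrite -E; exists a.
exists [set a : corner He | m (val a)]; split.
  split.
  - split=> [|a b ma mb|r a ma]; rewrite /mkset.
    + by rewrite corner0E.
    + by rewrite cornerDE; apply: mD.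
    + by rewrite cornerME; apply: mM.
  - move=> E; apply: mN0; apply/seteqP; split=> [x mx|x ->] //=.
    have : [set a : corner He | m (val a)] (to_corner He x).
      by rewrite /mkset val_to_corner me.
    by rewrite E => /(congr1 val); rewrite corner0E val_to_corner me.
  - by move=> E; apply: mNe; rewrite -(corner1E He) -[m _]/([set a | m (val a)] _) E.
move=> I [Iid IN0 INT].
have [I0 ID IM] := Iid.
pose w := [set x | exists2 a, I a & val a = x].
have [|||wm|[a Ia ae]] := mU w.
- split; first by exists 0 => //; rewrite corner0E.
    by move=> _ _ [a Ia <-] [b Ib <-]; exists (a + b); [exact: ID|rewrite cornerDE].
  move=> r _ [a Ia <-]; exists (to_corner He r * a); first exact: IM.
  by rewrite cornerME val_to_corner mulrAC mul_corner_val mulrC.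
- by move=> /nontrivE; apply: contra_not IN0; apply.
- by move=> _ [a _ <-]; rewrite mul_corner_val.
- apply/seteqP; split=> a /=.
    rewrite -wm => -[b Ib /val_inj <-] //.
  by move=> Ia; rewrite -wm; exists a.
- case: INT; apply/seteqP; split=> // b _.
  rewrite -[b]mulr1; apply: IM.
  by rewrite (_ : 1 = a) //; apply: val_inj; rewrite ae corner1E.
Qed.

(** * Ideals, annihilators and minimal ideals *)

Section Ideals.
Variable R : comPzRingType.
Implicit Types I J K m w : set R.

Definition nonzero_ideal I : Prop := is_ideal I /\ I <> [set 0].

(** For ideals this is I J = 0, see [ideal_mul_eq0]; unlike the product it is
    convenient for arbitrary subsets. *)
Definition kills I J : Prop := forall a b, I a -> J b -> a * b = 0.

Definition annihilator J : set R := [set a | forall b, J b -> a * b = 0].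

Definition principal (a : R) : set R := [set x | exists r, x = r * a].

Definition ideal_add I J : set R :=
  [set x | exists a b, [/\ I a, J b & x = a + b]].

Definition minimal_ideal m : Prop :=
  nonzero_ideal m /\ forall w, nonzero_ideal w -> w `<=` m -> w = m.

Lemma killsC I J : kills I J -> kills J I.
Proof. by move=> IJ a b Ja Ib; rewrite mulrC; apply: IJ. Qed.

Lemma sub_killsl I I' J : I' `<=` I -> kills I J -> kills I' J.
Proof. by move=> sub IJ a b /sub; apply: IJ. Qed.

Lemma not_killsP I J : ~ kills I J -> exists a b, [/\ I a, J b & a * b <> 0].
Proof.
move=> nIJ; apply: contrapT => h; apply: nIJ => a b Ia Jb.
by apply: contrapT => ab; apply: h; exists a, b.
Qed.

Lemma is_idealN I a : is_ideal I -> I a -> I (- a).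
Proof. by move=> [_ _ IM] Ia; rewrite -mulN1r; apply: IM. Qed.

Lemma is_idealB I a b : is_ideal I -> I a -> I b -> I (a - b).
Proof. by move=> Iid Ia Ib; case: (Iid) => _ ID _; apply: ID => //; apply: is_idealN. Qed.

Lemma nonzero_idealP I : is_ideal I -> nonzero_ideal I <-> exists2 a, I a & a <> 0.
Proof.
move=> Iid; split=> [[_ IN0]|[a Ia a0]]; last by split=> // E; apply: a0; rewrite E in Ia.
apply: contrapT => h; apply: IN0; apply/seteqP; split=> [a Ia|a ->].
  by apply: contrapT => a0; apply: h; exists a.
by case: Iid.
Qed.

Lemma is_ideal_set0 : is_ideal [set 0 : R].
Proof.
by split=> // [a b|r a] /=; [move=> -> ->; rewrite addr0|move=> ->; rewrite mulr0].
Qed.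

Lemma is_ideal_setT : is_ideal [set: R].
Proof. by split. Qed.

Lemma is_ideal_principal a : is_ideal (principal a).
Proof.
split=> [|_ _ [r ->] [s ->]|r _ [s ->]].
- by exists 0; rewrite mul0r.
- by exists (r + s); rewrite mulrDl.
- by exists (r * s); rewrite mulrA.
Qed.

Lemma principal_self a : principal a a.
Proof. by exists 1; rewrite mul1r. Qed.

Lemma principal_sub I a : is_ideal I -> I a -> principal a `<=` I.
Proof. by move=> [_ _ IM] Ia _ [r ->]; apply: IM. Qed.

Lemma nonzero_principal a : a <> 0 -> nonzero_ideal (principal a).
Proof.
move=> a0; apply/nonzero_idealP; first exact: is_ideal_principal.
by exists a => //; apply: principal_self.
Qed.

Lemma kills_principal a J : annihilator J a -> kills (principal a) J.
Proof. by move=> aJ _ b [r ->] Jb; rewrite -mulrA aJ ?mulr0. Qed.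

Lemma is_ideal_annihilator J : is_ideal (annihilator J).
Proof.
split=> [b _|a b aJ bJ c Jc|r a aJ b Jb]; first by rewrite mul0r.
  by rewrite mulrDl aJ ?bJ ?addr0.
by rewrite -mulrA aJ ?mulr0.
Qed.

Lemma is_ideal_add I J : is_ideal I -> is_ideal J -> is_ideal (ideal_add I J).
Proof.
move=> [I0 ID IM] [J0 JD JM].
split=> [|_ _ [a [b [Ia Jb ->]]] [c [d [Ic Jd ->]]]|r _ [a [b [Ia Jb ->]]]].
- by exists 0, 0; rewrite addr0.
- by exists (a + c), (b + d); split; [exact: ID|exact: JD|rewrite addrACA].
- by exists (r * a), (r * b); split; [exact: IM|exact: JM|rewrite mulrDr].
Qed.

Lemma ideal_addSl I J : is_ideal J -> I `<=` ideal_add I J.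
Proof. by move=> [J0 _ _] a Ia; exists a, 0; rewrite addr0. Qed.

Lemma ideal_addSr I J : is_ideal I -> J `<=` ideal_add I J.
Proof. by move=> [I0 _ _] b Jb; exists 0, b; rewrite add0r. Qed.

Lemma kills_addl I J K : kills I K -> kills J K -> kills (ideal_add I J) K.
Proof.
move=> IK JK _ c [a [b [Ia Jb ->]]] Kc.
by rewrite mulrDl (IK a) // (JK b) // addr0.
Qed.

Lemma ideal_mul_in I J a b : I a -> J b -> ideal_mul I J (a * b).
Proof.
by move=> Ia Jb; exists 1%N, (fun=> a), (fun=> b); split=> //; rewrite big_ord1.
Qed.

Lemma ideal_mul_min I J K : is_ideal K ->
  (forall a b, I a -> J b -> K (a * b)) -> ideal_mul I J `<=` K.
Proof.
move=> [K0 KD _] IJK _ [n [a [b [Ia Jb ->]]]].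
by apply: big_ind => // i _; apply: IJK.
Qed.

Lemma ideal_mulSl I J : is_ideal I -> ideal_mul I J `<=` I.
Proof.
move=> Iid; apply: ideal_mul_min => // a b Ia _.
by case: Iid => _ _ IM; rewrite mulrC; apply: IM.
Qed.

Lemma ideal_mulSr I J : is_ideal J -> ideal_mul I J `<=` J.
Proof.
by move=> Jid; apply: ideal_mul_min => // a b _; case: Jid => _ _; apply.
Qed.

Lemma is_ideal_mul I J : is_ideal I -> is_ideal (ideal_mul I J).
Proof.
move=> [I0 _ IM]; split.
- by exists 0%N, (fun=> 0), (fun=> 0); split=> [[]//|[]//|]; rewrite big_ord0.
- move=> _ _ [n [a [b [Ia Jb ->]]]] [p [c [d [Ic Jd ->]]]].
  exists (n + p)%N,
    (fun i : 'I_(n + p) => match fintype.split i with inl j => a j | inr j => c j end),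
    (fun i : 'I_(n + p) => match fintype.split i with inl j => b j | inr j => d j end).
  split=> [i|i|]; try by case: (fintype.split i).
  rewrite big_split_ord /=; congr (_ + _); apply: eq_bigr => i _.
    by case: split_ordP => j => [/lshift_inj <-|/eqP]; rewrite ?eq_lrshift.
  by case: split_ordP => j => [/eqP|/rshift_inj <-]; rewrite ?eq_rlshift.
- move=> r _ [n [a [b [Ia Jb ->]]]].
  exists n, (fun i => r * a i), b; split=> [i||] //; first exact: IM.
  by rewrite mulr_sumr; apply: eq_bigr => i _; rewrite mulrA.
Qed.

Lemma ideal_mul_eq0 I J : is_ideal I -> is_ideal J ->
  ideal_mul I J = [set 0] <-> kills I J.
Proof.
move=> [I0 ? ?] [J0 _ _]; split=> [IJ a b Ia Jb|IJ].
  by have := ideal_mul_in Ia Jb; rewrite IJ.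
apply/seteqP; split; first exact: (ideal_mul_min is_ideal_set0 IJ).
by move=> _ ->; rewrite -[0](mulr0 (0 : R)); apply: ideal_mul_in.
Qed.

Lemma nonzero_ideal_mul I J : is_ideal I -> is_ideal J ->
  ~ kills I J -> nonzero_ideal (ideal_mul I J).
Proof.
move=> Iid Jid nIJ; split; first exact: is_ideal_mul.
by move=> /(ideal_mul_eq0 Iid Jid).
Qed.

(** If c0 b <> 0 with c0 in w and b in m, then minimality gives both m = R b and
    w b = m; so b = c b for some c in w, and c fixes all multiples of b. *)
Lemma minimal_ideal_fixed m w : minimal_ideal m -> is_ideal w ->
  ~ kills w m -> exists2 c, w c & forall a, m a -> c * a = a.
Proof.
move=> [[mid _] mmin] [w0 wD wM] /not_killsP[c0 [b [wc0 mb c0b]]].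
have b0 : b <> 0 by move=> b0; rewrite b0 mulr0 in c0b.
have mE := mmin _ (nonzero_principal b0) (principal_sub mid mb).
pose wb := [set x | exists2 c, w c & x = c * b].
have wbid : is_ideal wb.
  split=> [|_ _ [c wc ->] [d wd ->]|r _ [c wc ->]].
  - by exists 0 => //; rewrite mul0r.
  - by exists (c + d); [exact: wD|rewrite mulrDl].
  - by exists (r * c); [exact: wM|rewrite mulrA].
have wbE : wb = m.
  apply: mmin.
    by apply/nonzero_idealP => //; exists (c0 * b) => //; exists c0.
  by move=> _ [c _ ->]; case: mid => _ _; apply.
have : wb b by rewrite wbE.
case=> c wc cb; exists c => // a; rewrite -mE => -[r ->].
by rewrite mulrCA -cb.
Qed.

(** The ideal K turns out to be the factor eR with m as its non-trivial ideal,
    and Ann(K) the factor (1 - e)R. *)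
Lemma split_of_minimal_ideal K m :
  is_ideal K -> ~ K 1 -> minimal_ideal m -> m `<=` K -> kills m m ->
  ~ kills K m -> (forall d, K d -> annihilator m d -> m d) ->
  (forall a b, annihilator K a -> annihilator K b ->
     a * b = 0 -> a = 0 \/ b = 0) ->
  exists (D : idomainType) (S : comPzRingType),
    unique_nontrivial_ideal S /\ ring_iso R (D * S)%type.
Proof.
move=> Kid K1 mmin mK mm nKm Km Kdom.
have [KK0 KD KM] := Kid.
have [[mid mN0] mU] := mmin.
have [c Kc cm] := minimal_ideal_fixed mmin Kid nKm.
have [m0 mD mM] := mid.
have mc : m (c - c * c).
  apply: Km; first by apply: is_idealB => //; apply: KM.
  by move=> b mb; rewrite mulrBl -mulrA !cm ?subrr.
(* The polynomial 3c^2 - 2c^3 lifts an idempotent modulo a square-zero ideal: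
   it is congruent to c modulo c - c^2. *)
pose e := (3%:R - 2%:R * c) * c * c.
have Ke : K e by exact: KM.
have em a : m a -> e * a = a.
  move=> /cm ca.
  transitivity (3%:R * (c * (c * a)) - 2%:R * (c * (c * (c * a)))).
    by rewrite /e; ring.
  by rewrite !ca; ring.
have He : e * e = e.
  have sq : (c - c * c) * (c - c * c) = 0 by exact: mm.
  apply/subr0_eq.
  transitivity ((c - c * c) * (c - c * c) * (4%:R * c * c - 4%:R * c - 3%:R)).
    by rewrite /e; ring.
  by rewrite sq mul0r.
have ee' : e + (1 - e) = 1 by rewrite addrC subrK.
have He' : (1 - e) * (1 - e) = 1 - e.
  by rewrite mulrBl mul1r mulrBr mulr1 He subrr subr0.
(* Hence K = eR: (1 - e)t kills m, so it lies in m, where e acts as 1. *)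
have KE t : K t -> e * t = t.
  move=> Kt; have : m ((1 - e) * t).
    apply: Km; first exact: KM.
    by move=> b mb; rewrite mulrAC mulrBl mul1r em // subrr mul0r.
  by move=> /em; rewrite mulrA mulrBr mulr1 He subrr mul0r mulrBl mul1r => /esym/subr0_eq.
apply: (split_ring_iso He He' ee' _ _ mid mN0 em) => [e1|a b ea eb|me|w wid wN0 we].
- by apply: K1; rewrite (subr0_eq e1).
- have annK x : (1 - e) * x = x -> annihilator K x.
    move=> ex t /KE <-.
    by rewrite -ex mulrA [_ * e]mulrC mulrA mulrBr mulr1 He subrr !mul0r.
  by apply: Kdom; exact: annK.
- apply: mN0; apply/seteqP; split=> [a ma|a ->] //=.
  by rewrite -(em a ma); exact: mm.
- have wK : w `<=` K by move=> a wa; rewrite -(we a wa) mulrC; apply: KM.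
  have [wm|nwm] := pselect (kills w m).
    left; apply: mU => // a wa; apply: Km; first exact: wK.
    by move=> b; apply: wm.
  (* As e - b lies in m, its square is zero, and expanding the square of
     e = b + (e - b) exhibits e as a multiple of b. *)
  right; have [b wb bm] := minimal_ideal_fixed mmin wid nwm.
  have md : m (e - b).
    apply: Km; first by apply: is_idealB => //; exact: wK.
    by move=> a ma; rewrite mulrBl em // bm // subrr.
  have -> : e = (b + 2%:R * (e - b)) * b.
    have sq : (e - b) * (e - b) = 0 by exact: mm.
    transitivity (e * e - (e - b) * (e - b)); last by ring.
    by rewrite sq subr0 He.
  by case: wid => _ _; apply.
Qed.

End Ideals.

(** * A ring whose nonzero annihilated ideals form a horn splits *)

Section Horn.
Variables (R : comPzRingType) (X U Y : set (set R)) (v : set R).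

(** The horn, stated on ideals rather than on vertices.  A nonzero ideal that
    kills a nonzero one is a vertex, so the neighbourhood clauses apply to every
    nonzero ideal; each allows w to be the vertex itself, because the graph says
    nothing about squares. *)
Record horn_of_ideals : Prop := HornOfIdeals {
  hornX_neq0 : X !=set0;
  hornU_neq0 : U !=set0;
  hornY_neq0 : Y !=set0;
  hornX_ideal : forall x, X x -> nonzero_ideal x;
  hornU_ideal : forall u, U u -> nonzero_ideal u;
  hornv_ideal : nonzero_ideal v;
  hornY_ideal : forall y, Y y -> nonzero_ideal y;
  horn_XU : forall x u, X x -> U u -> kills x u;
  horn_Uv : forall u, U u -> kills u v;
  horn_vY : forall y, Y y -> kills v y;
  hornX_nbr : forall x w, X x -> nonzero_ideal w -> kills w x ->
    w = x \/ U w;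
  hornU_nbr : forall u w, U u -> nonzero_ideal w -> kills w u ->
    [\/ w = u, X w | w = v];
  hornv_nbr : forall w, nonzero_ideal w -> kills w v ->
    [\/ w = v, U w | Y w];
  hornY_nbr : forall y w, Y y -> nonzero_ideal w -> kills w y ->
    w = y \/ w = v;
  horn_disjXU : forall w, X w -> U w -> False;
  horn_disjXv : ~ X v;
  horn_disjXY : forall w, X w -> Y w -> False;
  horn_disjUv : ~ U v;
  horn_disjUY : forall w, U w -> Y w -> False
}.

Hypothesis G : horn_of_ideals.

Let Xid x (Xx : X x) : is_ideal x := (hornX_ideal G Xx).1.
Let Uid u (Uu : U u) : is_ideal u := (hornU_ideal G Uu).1.
Let vid : is_ideal v := (hornv_ideal G).1.
Let Yid y (Yy : Y y) : is_ideal y := (hornY_ideal G Yy).1.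

Lemma horn_nkills_Xv x : X x -> ~ kills x v.
Proof.
move=> Xx /(hornv_nbr G (hornX_ideal G Xx))[xv|Ux|Yx].
- by apply: (horn_disjXv G); rewrite -xv.
- exact: (horn_disjXU G Xx).
- exact: (horn_disjXY G Xx).
Qed.

Lemma horn_nkills_UY u y : U u -> Y y -> ~ kills u y.
Proof.
move=> Uu Yy /(hornY_nbr G Yy (hornU_ideal G Uu))[uy|uv].
- by apply: (horn_disjUY G Uu); rewrite uy.
- by apply: (horn_disjUv G); rewrite -uv.
Qed.

Lemma horn_nkills_XY x y : X x -> Y y -> ~ kills x y.
Proof.
move=> Xx Yy /(hornY_nbr G Yy (hornX_ideal G Xx))[xy|xv].
- by apply: (horn_disjXY G Xx); rewrite xy.
- by apply: (horn_disjXv G); rewrite -xv.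
Qed.

Lemma horn_U_antichain u w : U u -> U w -> kills w u -> w = u.
Proof.
move=> Uu Uw /(hornU_nbr G Uu (hornU_ideal G Uw))[//|Xw|wv].
- by case: (horn_disjXU G Xw Uw).
- by case: (horn_disjUv G); rewrite -wv.
Qed.

Lemma horn_annihilator_Uv u w : U u -> nonzero_ideal w ->
  kills w u -> kills w v -> w = u \/ w = v.
Proof.
move=> Uu wI wu wv.
case: (hornU_nbr G Uu wI wu) => [|Xw|]; [by left| |by right].
by case: (horn_nkills_Xv Xw wv).
Qed.

(** A nonzero w contained in v kills y, so w is v or y; it also kills u, which y
    does not. *)
Lemma horn_v_minimal : minimal_ideal v.
Proof.
split; first exact: hornv_ideal G.
move=> w wI wv.
have [y Yy] := hornY_neq0 G; have [u Uu] := hornU_neq0 G.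
case: (hornY_nbr G Yy wI (sub_killsl wv (horn_vY G Yy))) => // wy.
case: (horn_nkills_UY Uu Yy); rewrite -wy; apply/killsC.
exact: (sub_killsl wv (killsC (horn_Uv G Uu))).
Qed.

(** The product xy kills both u (through x) and v (through y). *)
Lemma horn_mul_XY x y u : X x -> Y y -> U u ->
  ideal_mul x y = v \/ ideal_mul x y = u.
Proof.
move=> Xx Yy Uu.
have [] // := @horn_annihilator_Uv u (ideal_mul x y) Uu.
- exact: nonzero_ideal_mul (Xid Xx) (Yid Yy) (horn_nkills_XY Xx Yy).
- exact: sub_killsl (ideal_mulSl (Xid Xx)) (horn_XU G Xx Uu).
- exact: sub_killsl (ideal_mulSr (Yid Yy)) (killsC (horn_vY G Yy)).
- by right.
- by left.
Qed.

(** If u + v were u, then v would be contained in u and killed by x; if it were v,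
    then u would be contained in v and killed by y.  So when u or v has square
    zero, u + v is adjacent to it, which locates u + v in X or in Y. *)
Lemma horn_addUv u (w := ideal_add u v) : U u ->
  [/\ nonzero_ideal w, v `<=` w, w <> u & w <> v].
Proof.
move=> Uu; have [x Xx] := hornX_neq0 G; have [y Yy] := hornY_neq0 G.
have vw : v `<=` w by apply: ideal_addSr (Uid Uu).
split=> // [|wE|wE].
- have [a va a0] := (nonzero_idealP vid).1 (hornv_ideal G).
  apply/nonzero_idealP; first exact: is_ideal_add (Uid Uu) vid.
  by exists a => //; apply: vw.
- apply: (horn_nkills_Xv Xx); apply/killsC; apply: (@sub_killsl _ u).
    by rewrite -wE.
  exact/killsC/(horn_XU G).
- apply: (horn_nkills_UY Uu Yy); apply: (@sub_killsl _ v).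
    by rewrite -wE; apply: ideal_addSl.
  exact: (horn_vY G).
Qed.

Lemma horn_addUv_Y u : U u -> kills v v -> Y (ideal_add u v).
Proof.
move=> Uu vv; have [x Xx] := hornX_neq0 G.
have [wN vw wu wv] := horn_addUv Uu.
case: (hornv_nbr G wN (kills_addl (horn_Uv G Uu) vv)) => // Uw.
case: (horn_nkills_Xv Xx); apply/killsC; apply: (sub_killsl vw).
exact/killsC/(horn_XU G).
Qed.

Lemma horn_addUv_X u : U u -> kills u u -> X (ideal_add u v).
Proof.
move=> Uu uu; have [wN vw wu wv] := horn_addUv Uu.
have wku := kills_addl uu (killsC (horn_Uv G Uu)).
by case: (hornU_nbr G Uu wN wku).
Qed.

(** With v v = 0 the ideal u + v is in Y, so u does not kill it; as u kills v,
    this gives u u <> 0.  A nonzero element that kills Ann(u) kills x and v, so it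
    generates a member of U; two members of U with product zero would coincide
    and have square zero. *)
Lemma horn_split_nilpotent : kills v v ->
  exists (D : idomainType) (S : comPzRingType),
    unique_nontrivial_ideal S /\ ring_iso R (D * S)%type.
Proof.
move=> vv; have [x Xx] := hornX_neq0 G; have [u0 Uu0] := hornU_neq0 G.
have uuN u : U u -> ~ kills u u.
  move=> Uu uu; apply: (horn_nkills_UY Uu (horn_addUv_Y Uu vv)); apply/killsC.
  by apply: kills_addl => //; apply/killsC/(horn_Uv G).
have xK : x `<=` annihilator u0 by move=> a xa b ub; apply: (horn_XU G Xx Uu0).
have vK : v `<=` annihilator u0.
  by move=> a va b ub; rewrite mulrC; apply: (horn_Uv G Uu0).
have annU a : a <> 0 -> annihilator (annihilator u0) a -> U (principal a).
  move=> a0 aK; have aN := nonzero_principal a0.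
  have aJ J : J `<=` annihilator u0 -> kills (principal a) J.
    by move=> JK; apply: kills_principal => b /JK; apply: aK.
  case: (hornX_nbr G Xx aN (aJ _ xK)) => // ax.
  by case: (horn_nkills_Xv Xx); rewrite -ax; apply: aJ.
apply: (@split_of_minimal_ideal _ (annihilator u0) v) => //.
- exact: is_ideal_annihilator.
- move=> K1; apply: (uuN _ Uu0) => a b ua _.
  by rewrite -[a]mul1r (K1 a ua) mul0r.
- exact: horn_v_minimal.
- by move=> Kv; apply: (horn_nkills_Xv Xx); apply: sub_killsl Kv.
- move=> d du dv; have [->|/eqP d0] := eqVneq d 0; first by case: vid.
  have [dE|<-] := horn_annihilator_Uv Uu0 (nonzero_principal d0)
    (kills_principal du) (kills_principal dv); last exact: principal_self.
  by case: (uuN _ Uu0); rewrite -{1}dE; apply: kills_principal.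
- move=> a b aK bK ab; have [->|/eqP a0] := eqVneq a 0; first by left.
  have [->|/eqP b0] := eqVneq b 0; first by right.
  have Ua := annU a a0 aK; have Ub := annU b b0 bK.
  have kab : kills (principal a) (principal b).
    by apply: kills_principal => _ [r ->]; rewrite mulrCA ab mulr0.
  by case: (uuN _ Ua); rewrite {2}(horn_U_antichain Ub Ua kab).
Qed.

(** The product xy equals every member of U, so U = {u} with u u = x y u = 0; then
    u + v is in X and does not kill v, which forces v v <> 0.  A nonzero element
    that kills Ann(v) kills y and u, so it generates v. *)
Lemma horn_split_idempotent x y : X x -> Y y -> ideal_mul x y <> v ->
  exists (D : idomainType) (S : comPzRingType),
    unique_nontrivial_ideal S /\ ring_iso R (D * S)%type.
Proof.
move=> Xx Yy xyNv; have [u Uu] := hornU_neq0 G.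
have xyE u' : U u' -> ideal_mul x y = u'.
  by move=> Uu'; case: (horn_mul_XY Xx Yy Uu').
have U_sub1 w : U w -> w = u by move=> Uw; rewrite -(xyE w Uw) (xyE u Uu).
have uu : kills u u.
  rewrite -{1}(xyE u Uu); apply: sub_killsl (horn_XU G Xx Uu).
  exact: ideal_mulSl (Xid Xx).
have vvN : ~ kills v v.
  move=> vv; apply: (horn_nkills_Xv (horn_addUv_X Uu uu)).
  by apply: kills_addl => //; apply: (horn_Uv G).
have uK : u `<=` annihilator v by move=> a ua b vb; apply: (horn_Uv G Uu).
have yK : y `<=` annihilator v.
  by move=> a ya b vb; rewrite mulrC; apply: (horn_vY G Yy).
have umin : minimal_ideal u.
  split=> [|w wN wu]; first exact: hornU_ideal G _ Uu.
  have wx := sub_killsl wu (killsC (horn_XU G Xx Uu)).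
  case: (hornX_nbr G Xx wN wx) => [wE|]; last exact: U_sub1.
  case: (horn_nkills_Xv Xx); rewrite -wE.
  exact: sub_killsl wu (horn_Uv G Uu).
have annv a : a <> 0 -> annihilator (annihilator v) a -> principal a = v.
  move=> a0 aK; have aN := nonzero_principal a0.
  have aJ J : J `<=` annihilator v -> kills (principal a) J.
    by move=> JK; apply: kills_principal => b /JK; apply: aK.
  case: (hornY_nbr G Yy aN (aJ _ yK)) => // ay.
  by case: (horn_nkills_UY Uu Yy); rewrite -ay; apply/killsC/aJ.
apply: (@split_of_minimal_ideal _ (annihilator v) u) => //.
- exact: is_ideal_annihilator.
- move=> K1; apply: vvN => a b va _.
  by rewrite -[a]mul1r (K1 a va) mul0r.
- by move=> Ku; apply: (horn_nkills_UY Uu Yy); apply/killsC; apply: sub_killsl Ku.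
- move=> d dv du; have [->|/eqP d0] := eqVneq d 0; first by case: (Uid Uu).
  have [<-|dE] := horn_annihilator_Uv Uu (nonzero_principal d0)
    (kills_principal du) (kills_principal dv); first exact: principal_self.
  by case: vvN; rewrite -{1}dE; apply: kills_principal.
- move=> a b aK bK ab; have [->|/eqP a0] := eqVneq a 0; first by left.
  have [->|/eqP b0] := eqVneq b 0; first by right.
  case: vvN; rewrite -{1}(annv a a0 aK) -(annv b b0 bK).
  by apply: kills_principal => _ [r ->]; rewrite mulrCA ab mulr0.
Qed.

Lemma horn_split :
  exists (D : idomainType) (S : comPzRingType),
    unique_nontrivial_ideal S /\ ring_iso R (D * S)%type.
Proof.
have [x Xx] := hornX_neq0 G; have [y Yy] := hornY_neq0 G.
have [xyv|] := pselect (ideal_mul x y = v); last exact: horn_split_idempotent.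
apply: horn_split_nilpotent; rewrite -{1}xyv.
apply: sub_killsl (ideal_mulSr (Yid Yy)) (killsC (horn_vY G Yy)).
Qed.

End Horn.

(** * From a horn of vertices to a horn of ideals *)

Lemma sval_Prop_inj (T : Type) (P : T -> Prop) (x y : {x | P x}) :
  sval x = sval y -> x = y.
Proof.
case: x y => [x hx] [y hy] /= xy; case: y / xy hy => hy.
by rewrite (Prop_irrelevance hx hy).
Qed.

Section VertexSets.
Variable R : comPzRingType.

Lemma AG_vertex_nonzero (I : AG R) : nonzero_ideal (sval I).
Proof. by case: I => I [? ? ?]. Qed.

Lemma AG_vertexP (I : set R) : AG_vertex I <->
  nonzero_ideal I /\ exists2 J, nonzero_ideal J & kills I J.
Proof.
split=> [[Iid IN0 [J [Jid JN0 /ideal_mul_eq0 IJ]]]|[[Iid IN0] [J [Jid JN0] IJ]]].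
  by split=> //; exists J => //; exact: IJ.
by split=> //; exists J; split=> //; apply/ideal_mul_eq0.
Qed.

Lemma AG_adjP (I J : AG R) : adj I J <-> I <> J /\ kills (sval I) (sval J).
Proof.
by rewrite /= /AG_adj ideal_mul_eq0 //; [case: (AG_vertex_nonzero I)|
  case: (AG_vertex_nonzero J)].
Qed.

Lemma disjoint_false T (A B : set T) t : A `&` B = set0 -> A t -> B t -> False.
Proof. by move=> AB At Bt; have : (A `&` B) t by []; rewrite AB. Qed.

Lemma bipartite_horn_of_ideals : bipartite_with_horn (AG R) ->
  exists (X U Y : set (set R)) (v : set R), horn_of_ideals X U Y v.
Proof.
move=> [X [U [v [Y [[X0 U0 Y0] [[XU Xv XY] [[Uv UY vY] [cover adjE]]]]]]]].
pose underlying (A : set (AG R)) := [set sval I | I in A].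
have inU (A : set (AG R)) I : underlying A (sval I) -> A I.
  by case=> J AJ /sval_Prop_inj <-.
have nbrE (I : AG R) w : nonzero_ideal w -> kills w (sval I) ->
    w = sval I \/ exists2 W : AG R, sval W = w & adj W I.
  move=> wN wI; have hw : AG_vertex w.
    by apply/AG_vertexP; split=> //; exists (sval I) => //; apply: AG_vertex_nonzero.
  have [|wNI] := pselect (w = sval I); first by left.
  right; exists (exist _ w hw) => //; apply/AG_adjP; split=> // E.
  by apply: wNI; rewrite -E.
have disj (A B : set (AG R)) w : A `&` B = set0 ->
    underlying A w -> underlying B w -> False.
  by move=> AB [I AI <-] /inU; apply: disjoint_false AB AI.
have edge I J : [\/ all_pairs X U I J, all_pairs U [set v] I J |
    all_pairs [set v] Y I J] -> kills (sval I) (sval J).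
  by move=> /adjE/AG_adjP[].
have dis := @disjoint_false (AG R).
exists (underlying X), (underlying U), (underlying Y), (sval v).
split.
- by case: X0 => I XI; exists (sval I), I.
- by case: U0 => I UI; exists (sval I), I.
- by case: Y0 => I YI; exists (sval I), I.
- by move=> _ [I _ <-]; apply: AG_vertex_nonzero.
- by move=> _ [I _ <-]; apply: AG_vertex_nonzero.
- exact: AG_vertex_nonzero.
- by move=> _ [I _ <-]; apply: AG_vertex_nonzero.
- by move=> _ _ [I XI <-] [J UJ <-]; apply: edge; apply: Or31; left.
- by move=> _ [I UI <-]; apply: edge; apply: Or32; left.
- by move=> _ [I YI <-]; apply: edge; apply: Or33; left.
- move=> _ w [I XI <-] wN /(nbrE _ _ wN)[|[W <- /adjE]]; first by left.
  case=> [[[_ UI]|[UW _]]|[[_ vI]|[_ UI]]|[[_ YI]|[_ vI]]].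
  + by case: (dis _ _ _ XU XI UI).
  + by right; exists W.
  + by case: (dis _ _ _ Xv XI vI).
  + by case: (dis _ _ _ XU XI UI).
  + by case: (dis _ _ _ XY XI YI).
  + by case: (dis _ _ _ Xv XI vI).
- move=> _ w [I UI <-] wN /(nbrE _ _ wN)[|[W <- /adjE]]; first by constructor 1.
  case=> [[[XW _]|[_ XI]]|[[_ vI]|[-> _]]|[[_ YI]|[_ vI]]].
  + by constructor 2; exists W.
  + by case: (dis _ _ _ XU XI UI).
  + by case: (dis _ _ _ Uv UI vI).
  + by constructor 3.
  + by case: (dis _ _ _ UY UI YI).
  + by case: (dis _ _ _ Uv UI vI).
- move=> w wN /(nbrE _ _ wN)[|[W <- /adjE]]; first by constructor 1.
  case=> [[[_ Uv']|[_ Xv']]|[[UW _]|[_ Uv']]|[[_ Yv]|[YW _]]].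
  + by case: (dis _ _ _ Uv Uv' erefl).
  + by case: (dis _ _ _ Xv Xv' erefl).
  + by constructor 2; exists W.
  + by case: (dis _ _ _ Uv Uv' erefl).
  + by case: (dis _ _ _ vY erefl Yv).
  + by constructor 3; exists W.
- move=> _ w [I YI <-] wN /(nbrE _ _ wN)[|[W <- /adjE]]; first by left.
  case=> [[[_ UI]|[_ XI]]|[[_ vI]|[_ UI]]|[[-> _]|[_ vI]]].
  + by case: (dis _ _ _ UY UI YI).
  + by case: (dis _ _ _ XY XI YI).
  + by case: (dis _ _ _ vY vI YI).
  + by case: (dis _ _ _ UY UI YI).
  + by right.
  + by case: (dis _ _ _ vY vI YI).
- by move=> w; apply: disj.
- by move=> /inU Xv'; case: (dis _ _ _ Xv Xv' erefl).
- by move=> w; apply: disj.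
- by move=> /inU Uv'; case: (dis _ _ _ Uv Uv' erefl).
- by move=> w; apply: disj.
Qed.

End VertexSets.

(** * The graph K_1 + D_r + K_1 + D_r *)

Definition horn_graph (r : Type) : sgraph :=
  seq_sum (complete_graph 1) (discrete_graph r)
          (complete_graph 1) (discrete_graph r).

Definition vX r : horn_graph r :=
  @SS1 (complete_graph 1) (discrete_graph r)
       (complete_graph 1) (discrete_graph r) ord0.
Definition vU r (a : r) : horn_graph r :=
  @SS2 (complete_graph 1) (discrete_graph r)
       (complete_graph 1) (discrete_graph r) a.
Definition hub r : horn_graph r :=
  @SS3 (complete_graph 1) (discrete_graph r)
       (complete_graph 1) (discrete_graph r) ord0.
Definition vY r (a : r) : horn_graph r :=
  @SS4 (complete_graph 1) (discrete_graph r)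
       (complete_graph 1) (discrete_graph r) a.

Lemma bipartite_with_horn_iso (G : sgraph) (r : Type) : inhabited r ->
  graph_iso G (horn_graph r) -> bipartite_with_horn G.
Proof.
move=> [r0] [f [[g gK fK] fadj]].
pose inX (t : horn_graph r) := if t is SS1 _ then True else False.
pose inU (t : horn_graph r) := if t is SS2 _ then True else False.
pose inv (t : horn_graph r) := if t is SS3 _ then True else False.
pose inY (t : horn_graph r) := if t is SS4 _ then True else False.
have vE : [set g (hub r)] = [set x | inv (f x)].
  apply/seteqP; split=> x /= => [->|]; first by rewrite fK.
  case E : (f x) => [i|a|i|a] // _; rewrite -[x]gK E.
  by rewrite [i]ord1.
exists [set x | inX (f x)], [set x | inU (f x)], (g (hub r)), [set x | inY (f x)].
rewrite vE; split; first split.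
- by exists (g (vX r)); rewrite /mkset fK.
- by exists (g (vU r0)); rewrite /mkset fK.
- by exists (g (vY r0)); rewrite /mkset fK.
have disj (A B : set (horn_graph r)) : (forall t, A t -> B t -> False) ->
    [set x | A (f x)] `&` [set x | B (f x)] = set0.
  by move=> h; apply/seteqP; split=> // x [/h].
split; first by split; apply: disj => -[].
split; first by split; apply: disj => -[].
split.
  apply/seteqP; split=> // x _ /=.
  by case: (f x) => [i|a|i|a]; [left; left; left|left; left; right|left; right|right].
move=> x y; rewrite fadj /all_pairs /mkset; move: (f x) (f y) => t t'.
have or3E (P Q S : Prop) : [\/ P, Q | S] <-> P \/ Q \/ S.
  by split=> [[]|[|[]]]; [left|right; left|do 2!right|constructor 1|
    constructor 2|constructor 3].
rewrite or3E.
by case: t => [i|a|i|a]; case: t' => [j|b|j|b];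
  rewrite /inX /inU /inv /inY /= ?[i]ord1 ?[j]ord1; tauto.
Qed.

(** * Rings with one non-trivial ideal, and ideals of a product *)

Lemma ideal_with1 (R : comPzRingType) (I : set R) : is_ideal I -> I 1 -> I = setT.
Proof.
move=> [_ _ IM] I1; apply/seteqP; split=> // a _.
by rewrite -[a]mulr1; apply: IM.
Qed.

Lemma kills0l (R : comPzRingType) (J : set R) : kills [set 0] J.
Proof. by move=> _ b -> _; rewrite mul0r. Qed.

Lemma kills0r (R : comPzRingType) (J : set R) : kills J [set 0].
Proof. exact/killsC/kills0l. Qed.

(** If m m <> 0, then minimality gives c in m that fixes m; whichever of the three
    ideals 1 - c generates, either 1 lies in m or 1 - c is a unit that kills m. *)
Lemma unique_nontrivial_idealP (S : comPzRingType) : unique_nontrivial_ideal S ->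
  exists m : set S, [/\ nontrivial_ideal m, kills m m &
    forall I, is_ideal I -> [\/ I = [set 0], I = m | I = setT]].
Proof.
move=> [m [mnt mU]]; have [mid mN0 mNT] := mnt; have [m0 mD mM] := mid.
have trichotomy I : is_ideal I -> [\/ I = [set 0], I = m | I = setT].
  move=> Iid; have [I0|I0] := pselect (I = [set 0]); first by constructor 1.
  have [IT|IT] := pselect (I = setT); first by constructor 3.
  by constructor 2; rewrite (mU I).
have mmin : minimal_ideal m.
  split=> // w [wid wN0] wm; case: (trichotomy w wid) => // wT.
  by case: mNT; apply/seteqP; split=> // a _; apply: wm; rewrite wT.
exists m; split=> //; apply: contrapT => nmm.
have [c mc cm] := minimal_ideal_fixed mmin mid nmm.
case: (trichotomy _ (is_ideal_principal (1 - c))) => cE.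
- have : principal (1 - c) (1 - c) by apply: principal_self.
  rewrite cE => /subr0_eq c1; apply: mNT; apply: ideal_with1 => //.
  by rewrite c1.
- have mc' : m (1 - c) by rewrite -cE; apply: principal_self.
  by apply: mNT; apply: ideal_with1 => //; rewrite -[1](subrK c); apply: mD.
- have [r rc] : principal (1 - c) 1 by rewrite cE.
  have c0 : c = 0.
    by rewrite -[c]mul1r rc -mulrA mulrBl mul1r cm // subrr mulr0.
  apply: mN0; apply/seteqP; split=> [a ma|a ->] //=.
  by rewrite -(cm a ma) c0 mul0r.
Qed.

Section ProductIdeals.
Variables (R A B : comPzRingType) (f : {rmorphism R -> (A * B)%type}).
Variables (g : A * B -> R) (gK : cancel f g) (fK : cancel g f).
Implicit Types (I : set A) (J : set B).

(** The ideal I x J, pulled back to R along the isomorphism f. *)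
Definition box I J : set R := [set x | I (f x).1 /\ J (f x).2].

Lemma is_ideal_box I J : is_ideal I -> is_ideal J -> is_ideal (box I J).
Proof.
move=> [I0 ID IM] [J0 JD JM]; split.
- by rewrite /box /mkset rmorph0.
- move=> x y [Ix Jx] [Iy Jy]; rewrite /box /mkset rmorphD.
  by split; [exact: ID|exact: JD].
- move=> r x [Ix Jx]; rewrite /box /mkset rmorphM.
  by split; [exact: IM|exact: JM].
Qed.

Lemma mem_box I J a b : box I J (g (a, b)) <-> I a /\ J b.
Proof. by rewrite /box /mkset fK. Qed.

Lemma box_inj I J I' J' : is_ideal I -> is_ideal J -> is_ideal I' ->
  is_ideal J' -> box I J = box I' J' -> I = I' /\ J = J'.
Proof.
move=> [I0 _ _] [J0 _ _] [I'0 _ _] [J'0 _ _] E.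
have E' a b : (I a /\ J b) <-> (I' a /\ J' b) by rewrite -!mem_box E.
split; apply/seteqP; split=> z zI.
- by case: ((E' z 0).1 _).
- by case: ((E' z 0).2 _).
- by case: ((E' 0 z).1 _).
- by case: ((E' 0 z).2 _).
Qed.

Lemma box_set0 : box [set 0] [set 0] = [set 0].
Proof.
apply/seteqP; split=> x; rewrite /box /mkset; last by move=> ->; rewrite rmorph0.
move=> [x1 x2]; apply: (can_inj gK).
by rewrite rmorph0 [LHS]surjective_pairing x1 x2.
Qed.

Lemma kills_box I J I' J' : is_ideal I -> is_ideal J -> is_ideal I' ->
  is_ideal J' -> kills (box I J) (box I' J') <-> kills I I' /\ kills J J'.
Proof.
move=> [I0 _ _] [J0 _ _] [I'0 _ _] [J'0 _ _]; split=> [k|[kI kJ]].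
  have E a b c d : I a -> J b -> I' c -> J' d -> (a, b) * (c, d) = 0 :> A * B.
    move=> Ia Jb I'c J'd; rewrite -(fK (a, b)) -(fK (c, d)) -rmorphM.
    by rewrite k ?rmorph0 //; apply/mem_box.
  split=> a b aI bI.
    by have [] := E a 0 b 0 aI J0 bI J'0.
  by have [] := E 0 a 0 b I0 aI I'0 bI.
move=> x y [Ix Jx] [I'y J'y]; apply: (can_inj gK).
rewrite rmorphM rmorph0 [f x]surjective_pairing [f y]surjective_pairing.
by congr pair; [exact: kI|exact: kJ].
Qed.

(** The idempotents (1, 0) and (0, 1) separate the coordinates of an ideal. *)
Lemma ideal_is_box K : is_ideal K ->
  exists I J, [/\ is_ideal I, is_ideal J & K = box I J].
Proof.
move=> [K0 KD KM].
have gE p x : f x = p -> g p = x by move=> <-.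
exists [set a | K (g (a, 0))], [set b | K (g (0, b))]; split.
- split=> [|a b Ka Kb|r a Ka]; rewrite /mkset.
  + by rewrite (gE _ 0) // rmorph0.
  + rewrite (gE _ (g (a, 0) + g (b, 0))); first exact: KD.
    by rewrite rmorphD !fK; congr pair; apply: addr0.
  + rewrite (gE _ (g (r, 0) * g (a, 0))); first exact: KM.
    by rewrite rmorphM !fK; congr pair; apply: mulr0.
- split=> [|a b Ka Kb|r a Ka]; rewrite /mkset.
  + by rewrite (gE _ 0) // rmorph0.
  + rewrite (gE _ (g (0, a) + g (0, b))); first exact: KD.
    by rewrite rmorphD !fK; congr pair; apply: addr0.
  + rewrite (gE _ (g (0, r) * g (0, a))); first exact: KM.
    by rewrite rmorphM !fK; congr pair; apply: mulr0.
apply/seteqP; split=> x.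
  move=> Kx; rewrite /box /mkset; split.
    rewrite (gE _ (g (1, 0) * x)); first exact: KM.
    by rewrite rmorphM fK; congr pair; [exact: mul1r|exact: mul0r].
  rewrite (gE _ (g (0, 1) * x)); first exact: KM.
  by rewrite rmorphM fK; congr pair; [exact: mul0r|exact: mul1r].
move=> [Kx1 Kx2]; rewrite (_ : x = g ((f x).1, 0) + g (0, (f x).2)).
  exact: KD.
apply: (can_inj gK); rewrite rmorphD !fK [LHS]surjective_pairing.
by congr pair; [exact/esym/addr0|exact/esym/add0r].
Qed.

End ProductIdeals.

(** * The number of nonzero ideals of a domain *)

Definition nonzero_ideals (A : comPzRingType) : Type :=
  {I : set A | nonzero_ideal I}.

Lemma nonzero_ideal_setT (A : comPzRingType) : (1 : A) <> 0 ->
  nonzero_ideal [set: A].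
Proof.
by move=> one0; apply/nonzero_idealP; [exact: is_ideal_setT|exists 1].
Qed.

Lemma inhabited_nonzero_ideals (D : idomainType) : inhabited (nonzero_ideals D).
Proof.
by split; exists setT; apply: nonzero_ideal_setT; apply/eqP/oner_neq0.
Qed.

(** Let a be a nonzero element of a proper ideal.  If two distinct powers of a
    generated the same ideal, cancelling the lower one would show that a is a
    unit. *)
Lemma one_or_infinite_nonzero_ideals (D : idomainType) :
  one_or_infinite (nonzero_ideals D).
Proof.
have TN : nonzero_ideal [set: D].
  by apply: nonzero_ideal_setT; apply/eqP/oner_neq0.
have [DT|/existsNP[I]] := pselect (forall I : set D, nonzero_ideal I -> I = setT).
  left; rewrite (_ : setT = [set exist _ setT TN : nonzero_ideals D]).
    exact: card_set1.
  apply/seteqP; split=> // I _; apply: sval_Prop_inj => /=.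
  by apply: DT; case: I.
move=> /not_implyP[IN INT]; right; apply/infiniteP.
have [a Ia /eqP a0] := (nonzero_idealP IN.1).1 IN.
have aN n : nonzero_ideal (principal (a ^+ n)).
  by apply: nonzero_principal; apply/eqP; rewrite expf_neq0.
pose p n : nonzero_ideals D := exist _ (principal (a ^+ n)) (aN n).
have p_neq n k : p n <> p (n + k.+1)%N.
  move=> /(congr1 sval) /= E.
  have [r] : principal (a ^+ (n + k.+1)) (a ^+ n) by rewrite -E; apply: principal_self.
  rewrite -{1}[a ^+ n]mulr1 exprD mulrCA => /(mulfI (expf_neq0 n a0)) ra.
  apply: INT; apply: ideal_with1; first exact: IN.1.
  by rewrite ra exprS mulrCA mulrC; case: IN.1 => _ _; apply.
have p_inj : injective p.
  move=> i j ij; case: (ltngtP i j) => // /subnKC; rewrite addSnnS => E;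
    by case: (p_neq _ _ (etrans _ (esym (congr1 p E)))).
rewrite (card_le_eql (card_esym (inj_card_eq (in2W p_inj)))).
exact: subset_card_le.
Qed.

(** * The annihilating-ideal graph of D x S *)

Lemma graph_isoP (G H : sgraph) (h : H -> G) :
  injective h -> (forall x, exists t, h t = x) ->
  (forall s t, adj s t <-> adj (h s) (h t)) -> graph_iso G H.
Proof.
move=> h_inj h_surj hadj.
pose k x := sval (cid (h_surj x)).
have kK : cancel k h by move=> x; rewrite /k; case: cid.
exists k; split; last by move=> x y; rewrite -{1}[x]kK -{1}[y]kK -hadj.
by exists h => // t; apply: h_inj; rewrite kK.
Qed.

Section AGProduct.
Variables (R : comPzRingType) (D : idomainType) (S : comPzRingType).
Variables (f : {rmorphism R -> (D * S)%type}) (g : D * S -> R).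
Hypotheses (gK : cancel f g) (fK : cancel g f).
Variable m : set S.
Hypotheses (m_nontrivial : nontrivial_ideal m) (mm : kills m m).
Hypothesis S_ideals : forall I : set S,
  is_ideal I -> [\/ I = [set 0], I = m | I = setT].

Local Notation r := (nonzero_ideals D).

(** The ideals attached to the four kinds of vertices are 0 x S, A x 0, 0 x m and
    A x m; their two coordinates are given separately because killing is decided
    coordinatewise. *)
Definition horn_fst (t : horn_graph r) : set D :=
  match t with SS1 _ => [set 0] | SS2 a => sval (a : r)
             | SS3 _ => [set 0] | SS4 a => sval (a : r) end.

Definition horn_snd (t : horn_graph r) : set S :=
  match t with SS1 _ => setT | SS2 _ => [set 0]
             | SS3 _ => m | SS4 _ => m end.

Definition horn_ideal (t : horn_graph r) : set R :=
  box f (horn_fst t) (horn_snd t).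

Let mid : is_ideal m := let: And3 mid _ _ := m_nontrivial in mid.
Let mN0 : m <> [set 0] := let: And3 _ mN0 _ := m_nontrivial in mN0.
Let mNT : m <> setT := let: And3 _ _ mNT := m_nontrivial in mNT.

Let TN0 : [set: S] <> [set 0].
Proof.
move=> T0; apply: mN0; apply/seteqP; split=> [a _|a ->]; first by rewrite -T0.
by case: mid.
Qed.

Let kTm : ~ kills setT m.
Proof.
move=> k; apply: mN0; apply/seteqP; split=> [a ma|a ->].
  by rewrite /set1 /mkset -[a]mul1r k.
by case: mid.
Qed.

Let kTT : ~ kills [set: S] setT.
Proof. by move=> k; apply: kTm => a b _ _; apply: k. Qed.

Lemma horn_fst_ideal t : is_ideal (horn_fst t).
Proof.
have aid (a : r) : is_ideal (sval a) by case: (svalP a).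
by case: t => [i|a|i|a]; [exact: is_ideal_set0|exact: aid|
  exact: is_ideal_set0|exact: aid].
Qed.

Lemma horn_snd_ideal t : is_ideal (horn_snd t).
Proof.
by case: t => [i|a|i|a] //; exact: is_ideal_set0.
Qed.

Lemma kills_horn_ideal s t : kills (horn_ideal s) (horn_ideal t) <->
  kills (horn_fst s) (horn_fst t) /\ kills (horn_snd s) (horn_snd t).
Proof.
by apply: (kills_box gK fK); try exact: horn_fst_ideal; exact: horn_snd_ideal.
Qed.

Lemma horn_ideal_inj : injective horn_ideal.
Proof.
move=> s t E.
have [] := box_inj fK (horn_fst_ideal s) (horn_snd_ideal s)
  (horn_fst_ideal t) (horn_snd_ideal t) E.
have aN0 (a : r) : sval a <> [set 0] by case: (svalP a).
have N0a (a : r) : [set 0] <> sval a by move/esym/aN0.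
have N0m : [set 0] <> m by move/esym.
have NTm : setT <> m by move/esym.
case: s t {E} => [i|a|i|a] [j|b|j|b] /=; rewrite ?[i]ord1 ?[j]ord1 //;
  try solve [by move=> /aN0|by move=> /N0a|by []];
  by move=> ab _; rewrite (sval_Prop_inj ab).
Qed.

Lemma domain_kills (I J : r) : ~ kills (sval I) (sval J).
Proof.
case: I J => [I IN] [J JN] /= k.
have [a Ia a0] := (nonzero_idealP IN.1).1 IN.
have [b Jb b0] := (nonzero_idealP JN.1).1 JN.
by have /eqP := k a b Ia Jb; rewrite mulf_eq0 => /orP[/eqP|/eqP].
Qed.

Lemma horn_ideal_neq0 t : horn_ideal t <> [set 0].
Proof.
rewrite -(box_set0 gK).
move=> /(box_inj fK (horn_fst_ideal t) (horn_snd_ideal t)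
  (is_ideal_set0 _) (is_ideal_set0 _)).
have aN0 (a : r) : sval a <> [set 0] by case: (svalP a).
by case: t => [i|a|i|a] [] /=; [move=> _ /TN0|move=> /aN0|move=> _ /mN0|move=> /aN0].
Qed.

Lemma horn_ideal_nonzero t : nonzero_ideal (horn_ideal t).
Proof.
split; last exact: horn_ideal_neq0.
by apply: is_ideal_box; [exact: horn_fst_ideal|exact: horn_snd_ideal].
Qed.

Lemma horn_ideal_vertex t : AG_vertex (horn_ideal t).
Proof.
have DT : nonzero_ideal [set: D].
  by apply: nonzero_ideal_setT; apply/eqP/oner_neq0.
pose I : r := exist _ setT DT.
apply/AG_vertexP; split; first exact: horn_ideal_nonzero.
exists (horn_ideal (match t with
  | SS1 _ => vU I | SS2 _ => vX r | _ => hub r end)).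
  exact: horn_ideal_nonzero.
by apply/kills_horn_ideal; case: t => [i|J|i|J] /=; split=> //;
  solve [exact: kills0l|exact: kills0r].
Qed.

(** The classification of ideals of S leaves the case A x S with A nonzero, which
    is excluded because its annihilator is zero. *)
Lemma horn_ideal_surj (I : set R) : AG_vertex I -> exists t, horn_ideal t = I.
Proof.
move=> /AG_vertexP[[Iid IN0] [J [Jid JN0] IJ]].
have [I1 [I2 [I1id I2id IE]]] := ideal_is_box gK fK Iid.
have [J1 [J2 [J1id J2id JE]]] := ideal_is_box gK fK Jid.
have [I10|I1N0] := pselect (I1 = [set 0]).
  have [I20|I2m|I2T] := S_ideals I2id.
  - by case: IN0; rewrite IE I10 I20 (box_set0 gK).
  - exists (hub r).
    by rewrite IE I10 I2m.
  - exists (vX r).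
    by rewrite IE I10 I2T.
pose I' : r := exist _ I1 (conj I1id I1N0).
have [I20|I2m|I2T] := S_ideals I2id.
- exists (vU I').
  by rewrite IE I20.
- exists (vY I').
  by rewrite IE I2m.
move: IJ; rewrite IE JE => /(kills_box gK fK I1id I2id J1id J2id)[k1 k2].
case: JN0; rewrite JE.
have -> : J1 = [set 0].
  apply: contrapT => J1N0.
  by apply: (@domain_kills I' (exist _ J1 (conj J1id J1N0))).
suff -> : J2 = [set 0] by exact: box_set0 gK.
apply/seteqP; split=> [b J2b|b ->]; last by case: J2id.
by rewrite /set1 /mkset -[b]mul1r k2 // I2T.
Qed.

Lemma horn_adjE s t : adj s t <->
  s <> t /\ kills (horn_ideal s) (horn_ideal t).
Proof.
rewrite kills_horn_ideal.
have kD := domain_kills.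
have kmT : ~ kills m setT by move=> /killsC.
have k0l I := @kills0l D I. have k0r I := @kills0r D I.
have l0l I := @kills0l S I. have l0r I := @kills0r S I.
by case: s t => [i|a|i|a] [j|b|j|b] /=; rewrite ?[i]ord1 ?[j]ord1;
  split=> [adjst|[neqst [kfst ksnd]]];
  first [by [] | by case: (kD _ _ kfst) | by case: (kTT ksnd)
    | by case: (kTm ksnd) | by case: (kmT ksnd)
    | by split; [|split; auto]].
Qed.

Lemma AG_product_iso : graph_iso (AG R) (horn_graph r).
Proof.
apply: (@graph_isoP _ _ (fun t => exist _ _ (horn_ideal_vertex t) : AG R)).
- by move=> s t /(congr1 sval) /horn_ideal_inj.
- move=> I; have [t tE] := horn_ideal_surj (svalP I).
  by exists t; apply: sval_Prop_inj.
- move=> s t; rewrite horn_adjE AG_adjP /=; split=> -[st k]; split=> // E.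
    by apply: st; apply: horn_ideal_inj; exact: (congr1 sval E).
  by apply: st; rewrite E.
Qed.

End AGProduct.

Lemma AG_iso_of_decomposition (R : comPzRingType) (D : idomainType)
    (S : comPzRingType) : unique_nontrivial_ideal S ->
  ring_iso R (D * S)%type ->
  graph_iso (AG R) (horn_graph (nonzero_ideals D)).
Proof.
move=> /unique_nontrivial_idealP[m [mnt mm trich]] [f [g gK fK]].
exact: (AG_product_iso gK fK mnt mm trich).
Qed.

Theorem theorem4p3 (R : comPzRingType) :
  (bipartite_with_horn (AG R) <->
     exists (D : idomainType) (S : comPzRingType),
       unique_nontrivial_ideal S /\ ring_iso R (D * S)%type) /\
  (bipartite_with_horn (AG R) ->
     exists r : Type,
       one_or_infinite r /\
       graph_iso (AG R)
         (seq_sum (complete_graph 1) (discrete_graph r)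
                  (complete_graph 1) (discrete_graph r))).
Proof.
have split_of_horn : bipartite_with_horn (AG R) ->
    exists (D : idomainType) (S : comPzRingType),
      unique_nontrivial_ideal S /\ ring_iso R (D * S)%type.
  by move=> /bipartite_horn_of_ideals[X [U [Y [v]]]]; apply: horn_split.
split; first split=> // -[D [S [Suniq RDS]]].
  apply: (@bipartite_with_horn_iso _ (nonzero_ideals D)).
    exact: inhabited_nonzero_ideals.
  exact: AG_iso_of_decomposition Suniq RDS.
move=> /split_of_horn[D [S [Suniq RDS]]].
exists (nonzero_ideals D); split; first exact: one_or_infinite_nonzero_ideals.
exact: AG_iso_of_decomposition Suniq RDS.
Qed.
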